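(* There exists an absolute constant $c>0$ such that for every $\varepsilon>0$ and every integer $k\ge c/\varepsilon$ there is a constant $C(k)$ depending only on $k$ such that the following holds whenever $q\ge n^{1+\varepsilon}$: for every $v\in[n]^2$ and every $\alpha\in\{(0,\pm1),(\pm1,0)\}$, $$\mathbb P\big[\exists f\in S_k(v)\ \text{with}\ f(\alpha)\neq v+\alpha\big]\le C(k)\,n^{-2-\varepsilon/2}.$$
   Context: Let $n,q$ be positive integers, $[m]=\{1,\dots,m\}$, $[a,b]=\{a,a+1,\dots,b\}$. Every vertex $v\in[n]^2$ has four incident edges $\uparrow(v),\downarrow(v),\rightarrow(v),\leftarrow(v)$, where $\rightarrow(i,j)=\leftarrow(i+1,j)$ is the edge between $(i,j)$ and $(i+1,j)$ and $\uparrow(i,j)=\downarrow(i,j+1)$ is the edge between $(i,j)$ and $(i,j+1)$; for boundary vertices the edges leading out of $[n]^2$ are included. A random puzzle is a coloring $\sigma$ of all these edges (including boundary edges) by independent uniform colors in $[q]$. For $v\in[n]^2$ and an integer $k\ge1$, $S_k(v)$ is the (random) set of injective maps $f:[-k,k]^2\to[n]^2$ with $f(0,0)=v$ that are feasible, i.e. $\sigma(\rightarrow(f(i,j)))=\sigma(\leftarrow(f(i+1,j)))$ whenever $(i,j),(i+1,j)\in[-k,k]^2$ and $\sigma(\uparrow(f(i,j)))=\sigma(\downarrow(f(i,j+1)))$ whenever $(i,j),(i,j+1)\in[-k,k]^2$. *)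

(* Defs.v *)
From Stdlib Require Import Reals ZArith.
From mathcomp Require Import all_boot.
Set Implicit Arguments. Unset Strict Implicit. Unset Printing Implicit Defensive.

(* Vertices of [n]^2, 0-indexed: vertex (x,y) stands for (x+1,y+1). *)
Definition vertex (n : nat) := ('I_n * 'I_n)%type.

(* Edges, including boundary edges.
   inl (a, y) : horizontal edge between columns a-1 and a (0-indexed) in row y,
                a ranges over 0..n (a = 0 and a = n are boundary edges).
   inr (x, b) : vertical edge between rows b-1 and b in column x. *)
Definition edge (n : nat) := ('I_n.+1 * 'I_n + 'I_n * 'I_n.+1)%type.

Definition eright n (u : vertex n) : edge n := inl (inord (u.1 : nat).+1, u.2).
Definition eleft  n (u : vertex n) : edge n := inl (inord (u.1 : nat), u.2).
Definition eup    n (u : vertex n) : edge n := inr (u.1, inord (u.2 : nat).+1).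
Definition edown  n (u : vertex n) : edge n := inr (u.1, inord (u.2 : nat)).

Definition coloring (n q : nat) := {ffun edge n -> 'I_q}.

(* The box [-k,k]^2, with index i : 'I_(2k+1) standing for i - k. *)
Definition box (k : nat) := ('I_(k.*2).+1 * 'I_(k.*2).+1)%type.

Definition center (k : nat) : box k := (inord k, inord k).

Definition feasible n q k (sigma : coloring n q) (f : {ffun box k -> vertex n}) : bool :=
  [forall i : box k,
     ((i.1 : nat).+1 < (k.*2).+1) ==>
       (sigma (eright (f i)) == sigma (eleft (f (inord (i.1 : nat).+1, i.2))))]
  && [forall i : box k,
     ((i.2 : nat).+1 < (k.*2).+1) ==>
       (sigma (eup (f i)) == sigma (edown (f (i.1, inord (i.2 : nat).+1))))].

Definition inS n q k (sigma : coloring n q) (v : vertex n) (f : {ffun box k -> vertex n}) : bool :=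
  [&& injectiveb f, f (center k) == v & feasible sigma f].

(* The point alpha in [-k,k]^2 (alpha has coordinates in {-1,0,1}, k >= 1). *)
Definition box_pt (k : nat) (alpha : Z * Z) : box k :=
  (inord (Z.to_nat (Z.of_nat k + alpha.1)), inord (Z.to_nat (Z.of_nat k + alpha.2))).

(* f(alpha) <> v + alpha, comparing integer coordinates (v + alpha may lie outside [n]^2). *)
Definition moved n k (f : {ffun box k -> vertex n}) (v : vertex n) (alpha : Z * Z) : bool :=
  ~~ (Z.eqb (Z.of_nat (f (box_pt k alpha)).1) (Z.of_nat v.1 + alpha.1)%Z
      && Z.eqb (Z.of_nat (f (box_pt k alpha)).2) (Z.of_nat v.2 + alpha.2)%Z).

Definition bad_event n q k (v : vertex n) (alpha : Z * Z) (sigma : coloring n q) : bool :=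
  [exists f : {ffun box k -> vertex n}, inS sigma v f && moved f v alpha].

(* Probability under the uniform distribution on colorings
   (= independent uniform colors on each edge). *)
Definition prob_unif (T : finType) (E : pred T) : R :=
  Rdiv (INR #|[set x : T | E x]|) (INR #|T|).

(* Main.v *)
Require Import Defs.
From Stdlib Require Import Reals ZArith List Lra.
From mathcomp Require Import all_boot zify.
Set Implicit Arguments. Unset Strict Implicit. Unset Printing Implicit Defensive.

(* Fix an injective assembly g of a box of side M = 2k+1. Feasibility of g identifies colors of
   puzzle edges, one constraint per inner box edge; if R is the rank of these identifications, g is
   feasible with probability q^-R. Each puzzle edge lies on at most one constraint on either side,
   so the classes of identified edges are paths or cycles, and only the edges Z lying on cycles
   lose rank: R >= 2M(M-1) - |Z|. Let kappa be the number of clusters of box points whose images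
   are linked by edges of Z. Once the links are prescribed, n^(2(kappa-1)) maps g remain, so a union
   bound works as soon as 2 k kappa <= (k+9) R.
   In a cluster c, the last point of every row (column) has no right (upper) edge in Z, so with a
   and b such ends, |c| <= a b, and R >= sum_c (a_c + b_c) - 2M. If 2 k kappa > (k+9) R, this forces
   2R < k; then there are fewer than k nontrivial constraints, and some concentric square has
   a trivial boundary. Restricted to that square, the assembly satisfies 2 kappa <= R: the boundary
   is moved rigidly and lies in one cluster, and either this cluster has a hole, which creates two
   extra ends, or there is only one cluster and at least three nontrivial constraints around the
   center. *)

(** * Rank of a system of color constraints *)

Definition crel (V X : finType) (S : {set X}) (l r : X -> V) : rel V :=
  [rel x y | [exists s in S, ((l s == x) && (r s == y)) || ((l s == y) && (r s == x))]].

(* Elements of the classes all of whose members occur both as a left and as a right side,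
   i.e. whose constraints form a cycle (possibly a loop). *)
Definition closed_pts (V X : finType) (S : {set X}) (l r : X -> V) : {set V} :=
  [set x | [forall y, connect (crel S l r) x y ==> (y \in l @: S) && (y \in r @: S)]].

(** The size of a spanning forest of the graph whose edges are the constraints. *)
Definition crank (V X : finType) (S : {set X}) (l r : X -> V) : nat :=
  #|V| - #|roots (crel S l r)|.

Lemma crel_connect_sym (V X : finType) (S : {set X}) (l r : X -> V) :
  connect_sym (crel S l r).
Proof.
apply: sym_connect_sym => x y; rewrite /crel /=.
by apply: eq_existsb => s; rewrite orbC.
Qed.

Lemma crel_root (V X : finType) (S : {set X}) (l r : X -> V) (s : X) :
  s \in S -> root (crel S l r) (l s) = root (crel S l r) (r s).
Proof.
move=> sS; apply/(rootP (crel_connect_sym S l r)); apply: connect1.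
by apply/existsP; exists s; rewrite sS !eqxx.
Qed.

Lemma sum_by_root (T I : finType) (e : rel T) (h : I -> T) (A : {set I}) :
  connect_sym e -> \sum_(x in roots e) #|[set i in A | root e (h i) == x]| = #|A|.
Proof.
move=> es; rewrite -[RHS]sum1_card.
rewrite (partition_big (fun i => root e (h i)) (mem (roots e))) /=; last first.
  by move=> i _; exact: roots_root.
apply: eq_bigr => x _; rewrite -sum1_card.
by apply: eq_bigl => i; rewrite inE.
Qed.

Lemma sum_card_by_root (T : finType) (e : rel T) :
  connect_sym e -> \sum_(x in roots e) #|[set i | root e i == x]| = #|T|.
Proof.
move=> es; rewrite -cardsT -(sum_by_root id [set: T] es).
by apply: eq_bigr => x _; apply: eq_card => i; rewrite !inE.
Qed.

Lemma roots_le (T : finType) (e : rel T) : #|roots e| <= #|T|.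
Proof. exact: max_card. Qed.

Lemma card_class_in (V X : finType) (e : rel V) (S : {set X}) (h : X -> V) (x : V) :
  {in S &, injective h} ->
  #|[set s in S | root e (h s) == x]| <= #|[set y | root e y == x] :&: h @: S|.
Proof.
move=> hi; rewrite -(card_in_imset (f := h) (D := [set s in S | root e (h s) == x])).
  apply: subset_leq_card; apply/subsetP => y /imsetP[s]; rewrite inE => /andP[sS sx] ->.
  by rewrite !inE sx imset_f.
by move=> s t; rewrite !inE => /andP[sS _] /andP[tS _]; exact: hi.
Qed.

(* A class of m edges carries at most m constraints, and m of them only if the class is closed. *)
Lemma crank_ge_closed (V X : finType) (S : {set X}) (l r : X -> V) :
  {in S &, injective l} -> {in S &, injective r} ->
  #|S| <= crank S l r + #|closed_pts S l r|.
Proof.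
move=> li ri.
have es := crel_connect_sym S l r.
suff: #|S| + #|roots (crel S l r)| <= #|V| + #|closed_pts S l r|.
  by have := roots_le (crel S l r); rewrite /crank; lia.
have zle : \sum_(i in roots (crel S l r)) (i \in closed_pts S l r) <= #|closed_pts S l r|.
  rewrite -sum1_card big_mkcond /= [X in _ <= X]big_mkcond /=.
  by apply: leq_sum => i _; case: (_ \in roots _); case: (i \in closed_pts _ _ _).
rewrite -(sum_by_root l S es) -[#|roots _|]sum1_card -big_split /=.
apply: leq_trans (leq_add (leqnn _) zle); rewrite -(sum_card_by_root es) -big_split /=.
apply: leq_sum => x; rewrite inE => /eqP xr.
case: (boolP (x \in closed_pts S l r)) => [_|].
  rewrite leq_add2r (leq_trans (card_class_in _ x li)) //.
  by apply: subset_leq_card; apply: subsetIl.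
rewrite addn0 addn1 inE negb_forall => /existsP[y].
rewrite negb_imply negb_and => /andP[xy yn].
have yx : root (crel S l r) y == x by rewrite -xr eq_sym root_connect.
have proper_le (h : X -> V) : y \notin h @: S -> {in S &, injective h} ->
    #|[set s in S | root (crel S l r) (h s) == x]| < #|[set z | root (crel S l r) z == x]|.
  move=> yh hi; apply: (leq_ltn_trans (card_class_in _ x hi)); apply: proper_card.
  rewrite properE subsetIl /=; apply/subsetPn; exists y; rewrite !inE ?yx //.
case/orP: yn => yn; first exact: proper_le.
(* Both sides of a constraint have the same root, so the constraints of a class may equally be
   counted by their right sides, which omit [y] in this case. *)
rewrite (_ : [set s in S | _] = [set s in S | root (crel S l r) (r s) == x]).
  exact: proper_le.
apply/setP => s; rewrite !inE; case: (boolP (s \in S)) => //= sS.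
by rewrite (crel_root l r sS).
Qed.

(** A class of m elements has rank m - 1 and carries at most m constraints, their left sides being
    distinct. For m >= 2 this suffices, as m <= 2(m - 1); a class of one element carries only
    loops. *)
Lemma crank_ge_nontrivial (V X : finType) (S : {set X}) (l r : X -> V) :
  {in S &, injective l} ->
  #|[set s in S | l s != r s]| <= 2 * crank S l r.
Proof.
move=> li; have es := crel_connect_sym S l r.
suff: #|[set s in S | l s != r s]| + 2 * #|roots (crel S l r)| <= 2 * #|V|.
  by have := roots_le (crel S l r); rewrite /crank; lia.
rewrite -(sum_by_root l _ es) -[#|roots _|]sum1_card big_distrr /= -big_split /=.
rewrite -(sum_card_by_root es) big_distrr /=.
apply: leq_sum => x; rewrite inE => /eqP xr.
set A := [set s in _ | _]; set K := [set i | _].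
have AK : #|A| <= #|K|.
  apply: leq_trans (card_class_in _ x _) _; last exact: subset_leq_card (subsetIl _ _).
  by move=> s t; rewrite !inE => /andP[sS _] /andP[tS _]; exact: li.
have xK : x \in K by rewrite inE xr.
have K0 : 0 < #|K| by apply/card_gt0P; exists x.
have [K1|K1] := leqP #|K| 1; last by lia.
suff -> : A = set0 by rewrite cards0; lia.
apply/setP => s; rewrite !inE; apply/negP => /andP[/andP[sS /eqP ns] rs]; apply: ns.
have inK y : y \in K -> y = x.
  by move=> yK; apply: (card_le1_eqP K1).
have lx : l s = x by apply: inK; rewrite inE.
have rx : r s = x by apply: inK; rewrite inE -(crel_root l r sS).
by rewrite lx rx.
Qed.

(** By injectivity no other constraint touches the point of a loop, so its class is a single point
    that occurs on both sides. *)
Lemma trivial_closed (V X : finType) (S : {set X}) (l r : X -> V) (s : X) :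
  {in S &, injective l} -> {in S &, injective r} ->
  s \in S -> l s = r s -> l s \in closed_pts S l r.
Proof.
move=> li ri sS lr.
have cl : closed (crel S l r) [pred y | y == l s].
  apply: (intro_closed (crel_connect_sym S l r)) => x y /existsP[t /andP[tS]].
  rewrite !inE => /orP[] /andP[/eqP <- /eqP <-] /eqP e.
    by rewrite (li t s tS sS e) lr.
  by rewrite (ri t s tS sS _) // e.
rewrite inE; apply/forallP => y; apply/implyP => /(closed_connect cl).
rewrite !inE eqxx => /esym/eqP ->.
by rewrite imset_f //= lr imset_f.
Qed.

Lemma card_colorings_le (V X : finType) (S : {set X}) (l r : X -> V) (q : nat) :
  #|[set sg : {ffun V -> 'I_q} | [forall s in S, sg (l s) == sg (r s)]]|
    <= q ^ #|roots (crel S l r)|.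
Proof.
set A := [set sg | _]; set e := crel S l r.
pose h (sg : {ffun V -> 'I_q}) := [ffun x : {x | x \in roots e} => sg (val x)].
have -> : q ^ #|roots e| = #|{ffun {x | x \in roots e} -> 'I_q}|.
  by rewrite card_ffun card_ord card_sig.
have constant sg x y : sg \in A -> connect e x y -> sg x = sg y.
  rewrite inE => /forall_inP sgA.
  have cl : closed e [pred z | sg z == sg x].
    apply: (intro_closed (crel_connect_sym S l r)) => a b /existsP[t /andP[tS]].
    rewrite !inE => /orP[] /andP[/eqP <- /eqP <-].
      by rewrite -(eqP (sgA _ tS)).
    by rewrite (eqP (sgA _ tS)).
  by move/(closed_connect cl); rewrite !inE eqxx => /esym/eqP ->.
rewrite -(card_in_imset (f := h) (D := A)); first exact: max_card.
move=> s1 s2 s1A s2A /ffunP eh; apply/ffunP => x.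
rewrite (constant s1 x (root e x)) ?connect_root // (constant s2 x (root e x)) ?connect_root //.
have rx : root e x \in roots e by exact: roots_root (crel_connect_sym S l r) x.
by have := eh (exist (fun z => z \in roots e) _ rx); rewrite !ffunE.
Qed.

(** A map in [G] is determined by its values at the roots. The value at the root of [c] is already
    forced by [g c = v], so that slot can store an arbitrary element of [W]; this gives an injection
    of [G * W] and avoids an exponent reduced by one. *)
Lemma card_maps_by_roots (T W : finType) (e : rel T) (G : {set {ffun T -> W}}) (c : T) (v : W) :
  connect_sym e ->
  (forall g g' u w, g \in G -> g' \in G -> e u w -> g u = g' u -> g w = g' w) ->
  (forall g, g \in G -> g c = v) ->
  #|G| * #|W| <= #|W| ^ #|roots e|.
Proof.
move=> es eG cG.
have eG' g g' u w : g \in G -> g' \in G -> connect e u w -> g u = g' u -> g w = g' w.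
  move=> gG g'G uw gu.
  have cl : closed e [pred z | g z == g' z].
    apply: (intro_closed es) => a b ab; rewrite !inE => /eqP ga.
    by rewrite (eG _ _ _ _ gG g'G ab ga).
  by move: (closed_connect cl uw); rewrite !inE gu eqxx => /esym/eqP.
pose h (p : {ffun T -> W} * W) :=
  [ffun x : {x | x \in roots e} => if val x == root e c then p.2 else p.1 (val x)].
have -> : #|W| ^ #|roots e| = #|{ffun {x | x \in roots e} -> W}| by rewrite card_ffun card_sig.
rewrite -[#|W|]cardsT -cardsX -(card_in_imset (f := h)); first exact: max_card.
move=> [g w] [g' w']; rewrite !inE /= => /andP[gG _] /andP[g'G _] /ffunP eh.
have rr x : root e x \in roots e by exact: roots_root es x.
have -> : w = w' by have := eh (exist (fun z => z \in roots e) _ (rr c)); rewrite !ffunE /= eqxx.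
congr pair; apply/ffunP => x.
have rx : connect e (root e x) x by rewrite es connect_root.
apply: (eG' _ _ _ _ gG g'G rx).
have := eh (exist (fun z => z \in roots e) _ (rr x)); rewrite !ffunE /=; case: eqP => // ->.
move=> _; apply: (eG' _ _ c) => //; first exact: connect_root.
by rewrite !cG.
Qed.

(** * Geometry of the box and clusters of an assembly *)

(* The direction [true] is horizontal and [false] vertical; [crd d] is the coordinate that moves
   along [d] and [crd (~~ d)] the one that stays fixed. *)
Definition crd (T : Type) (d : bool) (v : T * T) : T := if d then v.1 else v.2.

(* Junk value on the last row or column, which [inner] excludes. *)
Definition step k (d : bool) (u : box k) : box k :=
  if d then (inord (u.1 : nat).+1, u.2) else (u.1, inord (u.2 : nat).+1).

Definition eout n (d : bool) (v : vertex n) : edge n := if d then eright v else eup v.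
Definition ein n (d : bool) (v : vertex n) : edge n := if d then eleft v else edown v.

Definition inner k : {set bool * box k} :=
  [set s : bool * box k | (@crd 'I_(k.*2).+1 s.1 s.2 : nat).+1 < (k.*2).+1].

Definition cout n k (g : {ffun box k -> vertex n}) (s : bool * box k) : edge n :=
  eout s.1 (g s.2).
Definition cin n k (g : {ffun box k -> vertex n}) (s : bool * box k) : edge n :=
  ein s.1 (g (step s.1 s.2)).

Lemma crd_ext (T : Type) d (u v : T * T) :
  crd d u = crd d v -> crd (~~ d) u = crd (~~ d) v -> u = v.
Proof. by case: u v => [u1 u2] [v1 v2]; case: d => /= -> ->. Qed.

Lemma crd_step k d (u : box k) : (d, u) \in inner k -> crd d (step d u) = (crd d u).+1 :> nat.
Proof. by rewrite inE; case: d => /= ui; rewrite inordK. Qed.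

Lemma crd_stepN k d (u : box k) : crd (~~ d) (step d u) = crd (~~ d) u.
Proof. by case: d. Qed.

Lemma step_inj k d (u v : box k) :
  (d, u) \in inner k -> (d, v) \in inner k -> step d u = step d v -> u = v.
Proof.
move=> ui vi uv; apply: (@crd_ext _ d); last by rewrite -(crd_stepN d u) uv crd_stepN.
by apply: val_inj; apply: succn_inj; rewrite /= -(crd_step ui) uv (crd_step vi).
Qed.

Lemma eout_inj n d d' (v v' : vertex n) : eout d v = eout d' v' -> (d, v) = (d', v').
Proof.
case: v v' => [v1 v2] [w1 w2]; case: d; case: d'; rewrite /eout /eright /eup //=.
  case=> /(congr1 val); rewrite /= !inordK ?ltnS ?ltn_ord ?(ltnW (ltn_ord _)) // => -[/val_inj -> ->] //.
case=> -> /(congr1 val); rewrite /= !inordK ?ltnS ?ltn_ord ?(ltnW (ltn_ord _)) // => -[/val_inj ->] //.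
Qed.

Lemma ein_inj n d d' (v v' : vertex n) : ein d v = ein d' v' -> (d, v) = (d', v').
Proof.
case: v v' => [v1 v2] [w1 w2]; case: d; case: d'; rewrite /ein /eleft /edown //=.
  by case=> /(congr1 val); rewrite /= !inordK ?ltnS 1?ltnW // => /val_inj -> ->.
by case=> -> /(congr1 val); rewrite /= !inordK ?ltnS 1?ltnW // => /val_inj ->.
Qed.

Lemma eout_ein_dir n d d' (v w : vertex n) : eout d v = ein d' w -> d = d'.
Proof. by case: d; case: d'. Qed.

Lemma eout_einE n d (v w : vertex n) :
  (eout d v == ein d w) = (crd d w == (crd d v).+1 :> nat) && (crd (~~ d) w == crd (~~ d) v).
Proof.
case: v w => [v1 v2] [w1 w2]; case: d; rewrite /eout /ein /= ; apply/eqP/andP => /=.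
- case=> /(congr1 val); rewrite /= !inordK ?ltnS ?ltn_ord ?(ltnW (ltn_ord _)) // => -> ->; by rewrite !eqxx.
- by case=> /eqP h /eqP e; rewrite /eright /eleft /eup /edown /= h e.
- case=> -> /(congr1 val); rewrite /= !inordK ?ltnS ?ltn_ord ?(ltnW (ltn_ord _)) // => ->; by rewrite !eqxx.
- by case=> /eqP h /eqP e; rewrite /eright /eleft /eup /edown /= h e.
Qed.

Lemma feasibleE n q k (sg : coloring n q) (f : {ffun box k -> vertex n}) :
  feasible sg f = [forall s in inner k, sg (cout f s) == sg (cin f s)].
Proof.
apply/andP/forall_inP => [[/forall_inP h1 /forall_inP h2] [d u]|h].
  by rewrite inE; case: d => /= ui; [exact: h1|exact: h2].
by split; apply/forall_inP => u ui; [have := h (true, u)|have := h (false, u)];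
  rewrite inE; apply.
Qed.

Lemma cout_inj n k (g : {ffun box k -> vertex n}) : injective g -> {in inner k &, injective (cout g)}.
Proof. by move=> gi [d u] [d' u'] _ _ /eout_inj [-> /gi ->]. Qed.

Lemma cin_inj n k (g : {ffun box k -> vertex n}) : injective g -> {in inner k &, injective (cin g)}.
Proof.
move=> gi [d u] [d' u'] ui ui' /ein_inj [/= dd /gi]; rewrite -{}dd in ui' *.
by move/(step_inj ui ui') ->.
Qed.

(** Each line of either direction loses only the pair at its last point, and [h] sends that pair to
    its line. *)
Lemma card_inner k : 2 * (k.*2.+1 * k.*2.+1) <= #|inner k| + 2 * k.*2.+1.
Proof.
have cX : #|~: inner k| <= 2 * k.*2.+1.
  have -> : 2 * k.*2.+1 = #|{: bool * 'I_k.*2.+1}| by rewrite card_prod card_bool card_ord.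
  pose h (s : bool * box k) := (s.1, crd (~~ s.1) s.2).
  rewrite -(card_in_imset (f := h)); first exact: max_card.
  move=> [d u] [d' v]; rewrite !inE /= => ui vi [dd' uv].
  rewrite -dd' in vi uv *; congr pair; apply: (@crd_ext _ d) => //; apply: val_inj => /=.
  move: ui vi (ltn_ord (crd d u)) (ltn_ord (crd d v)).
  by move: (nat_of_ord (crd d u)) (nat_of_ord (crd d v)) => a b; lia.
by have := cardsC (inner k); rewrite card_prod card_bool card_prod card_ord; lia.
Qed.

(** Together with [rk], the Z and R of the proof idea. *)
Definition closed_edges n k (g : {ffun box k -> vertex n}) : {set edge n} :=
  closed_pts (inner k) (cout g) (cin g).

Definition rk n k (g : {ffun box k -> vertex n}) : nat := crank (inner k) (cout g) (cin g).

(* [(d, (u, w))] is in the pattern when [g w] is the neighbor of [g u] in direction [d] and the puzzle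
   edge between them is closed. *)
Definition pattern n k (g : {ffun box k -> vertex n}) : {set bool * (box k * box k)} :=
  [set x | (eout x.1 (g x.2.1) \in closed_edges g) && (eout x.1 (g x.2.1) == ein x.1 (g x.2.2))].

Definition prel k (p : {set bool * (box k * box k)}) : rel (box k) :=
  [rel u w | [exists d, ((d, (u, w)) \in p) || ((d, (w, u)) \in p)]].

Definition kappa k (p : {set bool * (box k * box k)}) : nat := #|roots (prel p)|.

Lemma prel_connect_sym k (p : {set bool * (box k * box k)}) : connect_sym (prel p).
Proof.
by apply: sym_connect_sym => u w; apply: eq_existsb => d; rewrite orbC.
Qed.

Lemma closed_edge_out n k (g : {ffun box k -> vertex n}) e :
  e \in closed_edges g -> exists2 s, s \in inner k & e = cout g s.
Proof.
rewrite inE => /forallP/(_ e); rewrite connect0 /= => /andP[/imsetP[s si ->] _].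
by exists s.
Qed.

(** A closed edge is also a right side, hence an assembly point sits at its far end. *)
Lemma closed_edge_link n k (g : {ffun box k -> vertex n}) d u :
  eout d (g u) \in closed_edges g -> exists w, (d, (u, w)) \in pattern g.
Proof.
move=> h; have := h; rewrite inE => /forallP/(_ (eout d (g u))); rewrite connect0 /=.
move=> /andP[_ /imsetP[[d' s] si]]; rewrite /cin /= => e; have dd := eout_ein_dir e.
by exists (step d' s); rewrite inE h /= dd -{1}dd e.
Qed.

Lemma pattern_crd n k (g : {ffun box k -> vertex n}) d u w : (d, (u, w)) \in pattern g ->
  crd d (g w) = (crd d (g u)).+1 :> nat /\ crd (~~ d) (g w) = crd (~~ d) (g u).
Proof. by rewrite inE /= eout_einE => /andP[_ /andP[/eqP -> /eqP ->]]. Qed.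

Lemma pattern_root n k (g : {ffun box k -> vertex n}) d u w : (d, (u, w)) \in pattern g ->
  root (prel (pattern g)) w = root (prel (pattern g)) u.
Proof.
move=> h; apply/(rootP (prel_connect_sym (pattern g))); rewrite prel_connect_sym.
by apply: connect1; apply/existsP; exists d; rewrite h.
Qed.

(** A row of the image of a cluster has several of these ends when it is broken by gaps. *)
Definition open_ends n k (g : {ffun box k -> vertex n}) (d : bool) (r : box k) : {set box k} :=
  [set u | (root (prel (pattern g)) u == r) && (eout d (g u) \notin closed_edges g)].

(** The left side counts all pairs of a direction and a point whose outgoing edge is not closed.
    Since every closed edge leaves some assembly point, there are at most 2M^2 - |Z| such pairs,
    with M = 2k+1; [card_inner] and R >= |inner| - |Z| finish. *)
Lemma rk_ge_open n k (g : {ffun box k -> vertex n}) : injective g ->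
  \sum_(r in roots (prel (pattern g))) (#|open_ends g true r| + #|open_ends g false r|)
    <= rk g + 2 * k.*2.+1.
Proof.
move=> gi.
have h1 : #|inner k| <= rk g + #|closed_edges g|.
  exact: crank_ge_closed (cout_inj gi) (cin_inj gi).
pose O := [set s | cout g s \notin closed_edges g].
have h2 : #|closed_edges g| <= #|~: O|.
  apply: leq_trans (leq_imset_card (cout g) _); apply: subset_leq_card.
  apply/subsetP => e eZ; have [s _ es] := closed_edge_out eZ.
  by apply/imsetP; exists s => //; rewrite in_setC in_set negbK -es.
have h3 := cardsC O; rewrite card_prod card_bool card_prod card_ord in h3.
have h4 := card_inner k.
suff -> : \sum_(r in roots (prel (pattern g))) (#|open_ends g true r| + #|open_ends g false r|) = #|O|.
  by lia.
have -> : #|O| = \sum_d #|[set u | eout d (g u) \notin closed_edges g]|.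
  rewrite -sum1_card (partition_big fst xpredT) //=; apply: eq_bigr => d _.
  rewrite -sum1_card (reindex (fun u => (d, u))) /=; last first.
    by exists snd => [u _ //|[d' u]]; rewrite inE /= => /andP[_ /eqP ->].
  by apply: eq_bigl => u; rewrite !inE eqxx andbT.
rewrite big_bool big_split /=; congr (_ + _).
  rewrite -(sum_by_root id [set u | eout true (g u) \notin closed_edges g] (prel_connect_sym (pattern g))).
  by apply: eq_bigr => r _; apply: eq_card => u; rewrite !inE andbC.
rewrite -(sum_by_root id [set u | eout false (g u) \notin closed_edges g] (prel_connect_sym (pattern g))).
by apply: eq_bigr => r _; apply: eq_card => u; rewrite !inE andbC.
Qed.

(** Follow closed edges in direction [d]: each raises the coordinate along [d], which is below n, so
    the walk stops at an open end. The last clause records that it skips no position, so that a hole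
    in the cluster must stop it. *)
Lemma walk_to_open_end n k (g : {ffun box k -> vertex n}) d u :
  exists2 w, w \in open_ends g d (root (prel (pattern g)) u) &
    [/\ crd (~~ d) (g w) = crd (~~ d) (g u), crd d (g u) <= crd d (g w) &
     forall x : nat, crd d (g u) <= x <= crd d (g w) ->
       exists2 t, root (prel (pattern g)) t = root (prel (pattern g)) u &
         crd d (g t) = x :> nat /\ crd (~~ d) (g t) = crd (~~ d) (g u)].
Proof.
have [m] := ubnP (n - crd d (g u)); elim: m u => // m IH u.
rewrite ltnS => mu.
case: (boolP (eout d (g u) \in closed_edges g)) => [|ue]; last first.
  exists u; first by rewrite in_set eqxx.
  by split=> // x xu; exists u => //; split=> //; apply/eqP; rewrite eqn_leq.
move=> /closed_edge_link [w uw]; have [w1 w2] := pattern_crd uw.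
have rw := pattern_root uw.
have [|t t1 [t2 t3 t4]] := IH w.
  by have := ltn_ord (crd d (g u)); have := ltn_ord (crd d (g w)); lia.
exists t; first by rewrite -rw.
split; rewrite -?w2 //; first by lia.
move=> x; rewrite leq_eqVlt => /andP[/orP[/eqP xu|xu] xt].
  by exists u => //; rewrite w2.
have [|z z1 z2] := t4 x; first by rewrite w1 xu.
by exists z; rewrite ?z1.
Qed.

(** The image of the cluster lies in the product of its two projections, and every line that it
    meets contains an end. *)
Lemma card_cluster_le n k (g : {ffun box k -> vertex n}) (r : box k) : injective g ->
  #|[set u | root (prel (pattern g)) u == r]| <= #|open_ends g true r| * #|open_ends g false r|.
Proof.
move=> gi; set c := [set u | _].
have proj d : #|[set crd (~~ d) (g u) | u in c]| <= #|open_ends g d r|.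
  apply: leq_trans (leq_imset_card (fun u => crd (~~ d) (g u)) _).
  apply: subset_leq_card; apply/subsetP => y /imsetP[u]; rewrite inE => /eqP ur ->.
  have [w wO [w2 _ _]] := walk_to_open_end g d u.
  by rewrite -w2; apply: imset_f; rewrite -ur.
apply: leq_trans (leq_mul (proj true) (proj false)); rewrite mulnC -cardsX.
rewrite -(card_imset _ gi); apply: subset_leq_card; apply/subsetP => y /imsetP[u uc ->].
rewrite inE; apply/andP; split.
  exact: (imset_f (fun u => crd (~~ false) (g u))).
exact: (imset_f (fun u => crd (~~ true) (g u))).
Qed.

Lemma sum_sq_le (I : finType) (P : pred I) (y : I -> nat) :
  \sum_(i | P i) y i ^ 2 <= (\sum_(i | P i) y i) ^ 2.
Proof.
elim/big_ind2: _ => // a b c d h1 h2.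
by apply: leq_trans (leq_add h1 h2) _; rewrite sqrnD leq_addr.
Qed.

(* The hypothesis [4 M^2 <= 4 kp + 4 Y + Y^2] forces the deficit [2 M - Y] to be at most [R / M + 4]. *)
Lemma small_rank_arith (k M R kp Y : nat) : M = k.*2.+1 ->
  2 * kp + Y <= R + 2 * M -> 4 * (M * M) <= 4 * kp + 4 * Y + Y * Y ->
  (k + 9) * R < 2 * k * kp -> 2 * R < k.
Proof.
move=> eM h1 h2 h3.
have h4 : 9 * R + k * Y < 2 * k * M by nia.
have h5 : Y < 2 * M by nia.
have [d ed] : exists d, 2 * M = Y + d by exists (2 * M - Y); lia.
have h6 : 9 * R < k * d by nia.
have h7 : 2 * kp <= R + d by lia.
have h8 : M * d <= R + 4 * M by nia.
have h9 : 9 * R * M < k * (R + 4 * M) by nia.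
(* For M = 2k+1, [h9] becomes 17kR + 9R < 8k^2 + 4k, which is impossible when 2R >= k; the constant
   9 is large enough for this. *)
rewrite ltnNge; apply/negP => h; have h10 : k * k <= k * (2 * R) by rewrite leq_mul2l h orbT.
by move: h9 h10 h; rewrite eM; clear; lia.
Qed.

Lemma sum_cluster_sizes n k (g : {ffun box k -> vertex n}) :
  \sum_(r in roots (prel (pattern g))) #|[set u | root (prel (pattern g)) u == r]|
    = k.*2.+1 * k.*2.+1.
Proof.
by rewrite (sum_card_by_root (prel_connect_sym (pattern g))) card_prod card_ord.
Qed.

Lemma open_ends_gt0 n k (g : {ffun box k -> vertex n}) d r :
  r \in roots (prel (pattern g)) -> 0 < #|open_ends g d r|.
Proof.
rewrite inE => /eqP rr; have [w wO _] := walk_to_open_end g d r.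
by apply/card_gt0P; exists w; rewrite -rr.
Qed.

(** With a + b = 2 + y for the two numbers of ends of a cluster, its size is at most ab, and 4ab <=
    (2 + y)^2 = 4 + 4y + y^2. Summing over the clusters gives the quadratic hypothesis of
    [small_rank_arith]. *)
Lemma small_rank n k (g : {ffun box k -> vertex n}) : injective g ->
  (k + 9) * rk g < 2 * k * kappa (pattern g) -> 2 * rk g < k.
Proof.
move=> gi; rewrite /kappa; set e := prel _.
pose a r := #|open_ends g true r|; pose b r := #|open_ends g false r|.
pose y r := a r + b r - 2.
have ey r : r \in roots e -> a r + b r = 2 + y r.
  by move=> rr; have := open_ends_gt0 true rr; have := open_ends_gt0 false rr; rewrite /y /a /b; lia.
have P : \sum_(r in roots e) (a r + b r) = 2 * #|roots e| + \sum_(r in roots e) y r.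
  by rewrite (eq_bigr _ ey) big_split /= sum_nat_const mulnC.
apply: (@small_rank_arith _ k.*2.+1 _ _ (\sum_(r in roots e) y r)) => //.
  by rewrite -P; exact: rk_ge_open.
rewrite -(sum_cluster_sizes g) big_distrr /=.
apply: leq_trans (_ : \sum_(r in roots e) (4 + 4 * y r + y r ^ 2) <= _).
  apply: leq_sum => r rr; apply: leq_trans (leq_mul (leqnn 4) (card_cluster_le r gi)) _.
  apply: leq_trans (leq_of_leqif (nat_AGM2 _ _)) _; rewrite (ey r rr).
  by rewrite -!mulnn; clear; lia.
rewrite 2!big_split /= sum_nat_const -big_distrr /= (mulnC #|_|) leq_add2l.
by rewrite mulnn; exact: sum_sq_le.
Qed.

Lemma few_nontrivial n k (g : {ffun box k -> vertex n}) : injective g ->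
  (k + 9) * rk g < 2 * k * kappa (pattern g) ->
  #|[set s in inner k | cout g s != cin g s]| < k.
Proof.
move=> gi h; apply: leq_ltn_trans (small_rank gi h).
exact: crank_ge_nontrivial (cout_inj gi).
Qed.

(** * Assemblies with trivial boundary *)

Lemma trivialE n k (g : {ffun box k -> vertex n}) d u :
  (cout g (d, u) == cin g (d, u)) =
  (crd d (g (step d u)) == (crd d (g u)).+1 :> nat) && (crd (~~ d) (g (step d u)) == crd (~~ d) (g u)).
Proof. by rewrite /cout /cin /= eout_einE. Qed.

Lemma step_comm k d (u : box k) : step d (step (~~ d) u) = step (~~ d) (step d u).
Proof. by case: u => u1 u2; case: d. Qed.

(* A unit square has displacement zero around it, so it cannot contain exactly one nontrivial side. *)
Lemma face_bottom n k (g : {ffun box k -> vertex n}) d u :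
  cout g (~~ d, u) = cin g (~~ d, u) ->
  cout g (~~ d, step d u) = cin g (~~ d, step d u) ->
  cout g (d, step (~~ d) u) = cin g (d, step (~~ d) u) ->
  cout g (d, u) = cin g (d, u).
Proof.
move=> /eqP h1 /eqP h2 /eqP h3; apply/eqP; move: h1 h2 h3.
rewrite !trivialE negbK step_comm => /andP[/eqP a1 /eqP a2] /andP[/eqP b1 /eqP b2] /andP[/eqP c1 /eqP c2].
apply/andP; split; first by rewrite -b2 c1 a2.
by apply/eqP; apply: val_inj; apply: succn_inj; rewrite /= -b1 -a1 c2.
Qed.

Lemma face_top n k (g : {ffun box k -> vertex n}) d u :
  cout g (~~ d, u) = cin g (~~ d, u) ->
  cout g (~~ d, step d u) = cin g (~~ d, step d u) ->
  cout g (d, u) = cin g (d, u) ->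
  cout g (d, step (~~ d) u) = cin g (d, step (~~ d) u).
Proof.
move=> /eqP h1 /eqP h2 /eqP h3; apply/eqP; move: h1 h2 h3.
rewrite !trivialE negbK step_comm => /andP[/eqP a1 /eqP a2] /andP[/eqP b1 /eqP b2] /andP[/eqP c1 /eqP c2].
apply/andP; split; first by rewrite b2 c1 a2.
by apply/eqP; apply: val_inj; rewrite /= b1 a1 c2.
Qed.

(** The edge borders two unit squares, and each must have a second nontrivial side. The one found in
    the upper square, [s1], and the one found in the lower square, [s2], differ because they lie on
    different levels. *)
Lemma three_nontrivial n k (g : {ffun box k -> vertex n}) d u :
  0 < k -> (d, u) \in inner k -> crd (~~ d) u = k :> nat ->
  cout g (d, u) != cin g (d, u) -> 2 < #|[set s in inner k | cout g s != cin g s]|.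
Proof.
move=> k0 ui uk s0.
have inN (s : bool * box k) : s \in inner k -> cout g s != cin g s ->
    s \in [set s in inner k | cout g s != cin g s].
  by move=> si sn; rewrite in_set si sn.
have hk : k.-1 < k.*2.+1 by clear; lia.
(* The neighbor of [u] one level below, the corner of the lower square. *)
pose u1 : box k := if d then (u.1, inord k.-1) else (inord k.-1, u.2).
have u1k : crd (~~ d) u1 = k.-1 :> nat by rewrite /u1; case: (d) => /=; rewrite inordK.
have u1E : step (~~ d) u1 = u.
  have hi : nat_of_ord (inord (inord k.-1 : 'I_k.*2.+1).+1 : 'I_k.*2.+1) = k.
    by rewrite inordK inordK ?prednK //; clear; lia.
  rewrite /u1; case: (u) uk => x y; case: (d) => /= uk; rewrite /step /=.
    by congr pair; apply: val_inj; rewrite /= hi uk.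
  by congr pair; apply: val_inj; rewrite /= hi uk.
have u1i : (~~ d, u1) \in inner k by rewrite in_set /= u1k; move: k0; clear; lia.
have ui' : (~~ d, u) \in inner k by rewrite in_set /= uk; move: k0; clear; lia.
have du1 : crd d u1 = crd d u by rewrite -u1E -{2}(negbK d) crd_stepN negbK.
have [s1 [s1i s1n s1E]] : exists s, [/\ s \in inner k, cout g s != cin g s &
   s.1 = ~~ d /\ crd (~~ d) s.2 = k :> nat \/ s.1 = d /\ crd (~~ d) s.2 = k.+1 :> nat].
  case: (eqVneq (cout g (~~ d, u)) (cin g (~~ d, u))) => h1; last first.
    by exists (~~ d, u); split=> //; left.
  case: (eqVneq (cout g (~~ d, step d u)) (cin g (~~ d, step d u))) => h2; last first.
    exists (~~ d, step d u); split=> //; last by left; rewrite crd_stepN.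
    by rewrite in_set /= crd_stepN uk; move: k0; clear; lia.
  exists (d, step (~~ d) u); split.
  - by move: ui; rewrite !in_set /= -{2}(negbK d) crd_stepN negbK.
  - by apply/negP => /eqP h3; move/eqP: s0; apply; exact: face_bottom.
  - by right; rewrite (crd_step ui') uk.
have [s2 [s2i s2n s2E]] : exists s, [/\ s \in inner k, cout g s != cin g s &
   crd (~~ d) s.2 = k.-1 :> nat].
  case: (eqVneq (cout g (~~ d, u1)) (cin g (~~ d, u1))) => h1; last first.
    by exists (~~ d, u1).
  case: (eqVneq (cout g (~~ d, step d u1)) (cin g (~~ d, step d u1))) => h2; last first.
    exists (~~ d, step d u1); split=> //; last by rewrite crd_stepN.
    by rewrite in_set /= crd_stepN u1k; move: k0; clear; lia.
  exists (d, u1); split => //.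
    by move: ui; rewrite !in_set /= du1.
  by apply/negP => /eqP h3; move/eqP: s0; apply; rewrite -u1E; exact: face_top.
have d1 : (d, u) != s1.
  apply/negP => /eqP e; move: s1E; rewrite -e /= uk => -[[]|[_]]; first by case: (d).
  by clear; lia.
have d2 : (d, u) != s2 by apply/negP => /eqP e; move: s2E; rewrite -e /= uk; move: k0; clear; lia.
have d3 : s1 != s2 by apply/negP => /eqP e; move: s1E; rewrite e s2E => -[[_]|[_]]; move: k0; clear; lia.
apply: (@leq_trans #|[set (d, u); s1; s2]|).
  by rewrite setUC cardsU1 cards2 !inE negb_or d1 eq_sym d2 eq_sym d3.
apply: subset_leq_card; apply/subsetP => s; rewrite !in_setU !in_set1.
by move=> /orP[/orP[] |] /eqP ->; exact: inN.
Qed.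

(** Coordinates relative to [d], the moving one first, so that rows and columns share one proof
    through [mkpN]. *)
Definition mkp k (d : bool) (a b : nat) : box k :=
  if d then (inord a, inord b) else (inord b, inord a).

Lemma mkpN k d a b : mkp k (~~ d) a b = mkp k d b a.
Proof. by case: d. Qed.

Lemma crd_mkp k d a b : a <= k.*2 -> crd d (mkp k d a b) = a :> nat.
Proof. by case: d => /= h; rewrite inordK. Qed.

Lemma crd_mkpN k d a b : b <= k.*2 -> crd (~~ d) (mkp k d a b) = b :> nat.
Proof. by rewrite -mkpN => h; rewrite crd_mkp. Qed.

Lemma step_mkp k d a b : a < k.*2 -> step d (mkp k d a b) = mkp k d a.+1 b.
Proof. by case: d => h; rewrite /mkp /step /= inordK // ltnW. Qed.

Lemma inner_mkp k d a b : a < k.*2 -> (d, mkp k d a b) \in inner k.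
Proof. by move=> h; rewrite in_set /= crd_mkp ?ltnS // ltnW. Qed.

Definition trivial_boundary n k (g : {ffun box k -> vertex n}) :=
  forall d u, (d, u) \in inner k -> crd (~~ d) u = 0 :> nat \/ crd (~~ d) u = k.*2 :> nat ->
    cout g (d, u) = cin g (d, u).

Lemma trivial_pattern n k (g : {ffun box k -> vertex n}) d u : injective g ->
  (d, u) \in inner k -> cout g (d, u) = cin g (d, u) -> (d, (u, step d u)) \in pattern g.
Proof.
move=> gi ui t; rewrite in_set /=; apply/andP; split; last by apply/eqP.
exact: (trivial_closed (cout_inj gi) (cin_inj gi) ui t).
Qed.

(** Trivial constraints are loops, hence links of the pattern: the line is translated rigidly and
    stays within one cluster. *)
Lemma boundary_line n k (g : {ffun box k -> vertex n}) d c i : injective g ->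
  trivial_boundary g -> c = 0 \/ c = k.*2 -> i <= k.*2 ->
  [/\ root (prel (pattern g)) (mkp k d i c) = root (prel (pattern g)) (mkp k d 0 c),
      crd d (g (mkp k d i c)) = crd d (g (mkp k d 0 c)) + i :> nat &
      crd (~~ d) (g (mkp k d i c)) = crd (~~ d) (g (mkp k d 0 c))].
Proof.
move=> gi tb hc; elim: i => [|i IH] hi; first by split; rewrite ?addn0.
have [h1 h2 h3] := IH (ltnW hi).
have ui := inner_mkp d c hi.
have cc : crd (~~ d) (mkp k d i c) = c :> nat by rewrite crd_mkpN //; case: hc => ->.
have t : cout g (d, mkp k d i c) = cin g (d, mkp k d i c).
  by apply: tb => //; rewrite cc.
have pt := trivial_pattern gi ui t; rewrite (step_mkp _ c hi) in pt.
have [p1 p2] := pattern_crd pt; rewrite (pattern_root pt) p1 p2 h1 h2 h3.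
by split; rewrite ?addnS.
Qed.

Lemma boundary_side n k (g : {ffun box k -> vertex n}) d y : injective g ->
  trivial_boundary g -> y <= k.*2 ->
  [/\ root (prel (pattern g)) (mkp k d 0 y) = root (prel (pattern g)) (mkp k true 0 0),
      crd d (g (mkp k d 0 y)) = crd d (g (mkp k true 0 0)) &
      crd (~~ d) (g (mkp k d 0 y)) = crd (~~ d) (g (mkp k true 0 0)) + y :> nat].
Proof.
move=> gi tb hy; have [h1 h2 h3] := boundary_line (~~ d) gi tb (or_introl erefl) hy.
rewrite !mkpN negbK in h1 h2 h3.
have e : mkp k d 0 0 = mkp k true 0 0 by case: (d).
by rewrite -e h1 h2 h3.
Qed.

(** Go from the corner along [d], then along the opposite side. *)
Lemma boundary_opposite n k (g : {ffun box k -> vertex n}) d y : injective g ->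
  trivial_boundary g -> y <= k.*2 ->
  [/\ root (prel (pattern g)) (mkp k d k.*2 y) = root (prel (pattern g)) (mkp k true 0 0),
      crd d (g (mkp k d k.*2 y)) = crd d (g (mkp k true 0 0)) + k.*2 :> nat &
      crd (~~ d) (g (mkp k d k.*2 y)) = crd (~~ d) (g (mkp k true 0 0)) + y :> nat].
Proof.
move=> gi tb hy; have [h1 h2 h3] := boundary_line (~~ d) gi tb (or_intror erefl) hy.
have [g1 g2 g3] := boundary_line d gi tb (or_introl erefl) (leqnn k.*2).
rewrite !mkpN negbK in h1 h2 h3.
have e : mkp k d 0 0 = mkp k true 0 0 by case: (d).
by rewrite -e h1 h2 h3 g1 g2 g3.
Qed.

(** If the cluster of the corner filled the whole translated square, it would have as many points as
    the box, and there would be no second cluster. *)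
Lemma missing_point n k (g : {ffun box k -> vertex n}) :
  1 < kappa (pattern g) ->
  let o := mkp k true 0 0 in
  exists p : box k, forall t, root (prel (pattern g)) t = root (prel (pattern g)) o ->
    ~ forall d, crd d (g t) = crd d (g o) + crd d p :> nat.
Proof.
move=> kap o; set e := prel _.
pose hit (p : box k) := [exists t, (root e t == root e o) &&
  [forall d, (crd d (g t) == crd d (g o) + crd d p :> nat)]].
have [/forallP all_hit|/forallPn [p np]] := boolP [forall p, hit p]; last first.
  exists p => t tr tp; move/existsP: np; apply; exists t.
  by rewrite tr eqxx; apply/forallP => d; apply/eqP.
pose c := [set t | root e t == root e o].
pose h (t : box k) : box k := (inord (crd true (g t) - crd true (g o)),
                               inord (crd false (g t) - crd false (g o))).
have cT : c = [set: box k].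
  apply/eqP; rewrite eqEcard subsetT /=; apply: leq_trans (leq_imset_card h (mem c)).
  apply: subset_leq_card; apply/subsetP => p _; have := all_hit p.
  move=> /existsP[t /andP[tr /forallP tp]]; apply/imsetP; exists t; first by rewrite inE.
  rewrite /h (eqP (tp true)) (eqP (tp false)) !addKn /=.
  by case: (p) => p1 p2 /=; rewrite !inord_val.
have : kappa (pattern g) <= 1; last by rewrite leqNgt kap.
rewrite /kappa -(card1 (root e o)); apply: subset_leq_card; apply/subsetP => r.
rewrite !inE => /eqP <-; have : r \in c by rewrite cT.
by rewrite inE.
Qed.

(** Each of the 2k+1 lines has an end at or beyond the opposite side of the boundary. On the line of
    the missing point, the walk from the near side stops before the hole, which gives one more end
    [u1]. *)
Lemma many_open_ends n k (g : {ffun box k -> vertex n}) d :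
  injective g -> trivial_boundary g -> 1 < kappa (pattern g) ->
  k.*2.+1 < #|open_ends g d (root (prel (pattern g)) (mkp k true 0 0))|.
Proof.
move=> gi tb kap; have [p miss] := missing_point kap; rewrite /= in miss.
set e := prel _ in miss *; set o := mkp k true 0 0 in miss *.
have le_crd (b : bool) : crd b p <= k.*2 by rewrite -ltnS.
have [l1 l2 l3] := boundary_side d gi tb (le_crd (~~ d)).
have [u1 u1O [u1r u1l u1x]] := walk_to_open_end g d (mkp k d 0 (crd (~~ d) p)).
rewrite -/e -/o in l1 l2 l3 u1O u1x; rewrite l1 in u1O u1x.
have u1lt : crd d (g u1) < crd d (g o) + crd d p.
  rewrite ltnNge; apply/negP => h.
  have [|t tr [t1 t2]] := u1x (crd d (g o) + crd d p); first by rewrite l2 leq_addr h.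
  apply: (miss t tr) => b; have [->|] := eqVneq b d; first exact: t1.
  move=> bd; have -> : b = ~~ d by case: (b) (d) bd => [] [].
  by rewrite t2 l3.
(* It remains to see that the ends other than [u1] project onto all 2k+1 lines. *)
rewrite (cardsD1 u1) u1O add1n ltnS -[X in X <= _](card_ord k.*2.+1).
pose h (t : box k) : 'I_k.*2.+1 := inord (crd (~~ d) (g t) - crd (~~ d) (g o)).
rewrite -cardsT; apply: leq_trans (leq_imset_card h _); apply: subset_leq_card.
apply/subsetP => y _; have yk : y <= k.*2 by rewrite -ltnS.
have [r1 r2 r3] := boundary_opposite d gi tb yk.
have [w wO [wr wl _]] := walk_to_open_end g d (mkp k d k.*2 y).
rewrite -/e -/o in r1 r2 r3 wO; rewrite r1 in wO.
apply/imsetP; exists w; last by rewrite /h wr r3 addKn inord_val.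
rewrite in_setD1 wO andbT; apply/negP => /eqP wu.
have := le_crd d; move: wl u1lt; rewrite wu r2; clear; lia.
Qed.

Lemma kappa_gt0 n k (g : {ffun box k -> vertex n}) : 0 < kappa (pattern g).
Proof.
apply/card_gt0P; exists (root (prel (pattern g)) (mkp k true 0 0)).
exact: (roots_root (prel_connect_sym (pattern g))).
Qed.

(** If there is one cluster, three nontrivial constraints force R >= 2. Otherwise the boundary
    cluster has at least 2(M + 1) ends, for M = 2k+1, and each other cluster at least 2, so
    [rk_ge_open] gives 2M + 2 kappa <= R + 2M. *)
Lemma trivial_boundary_rank n k (g : {ffun box k -> vertex n}) d u :
  injective g -> trivial_boundary g -> 0 < k ->
  (d, u) \in inner k -> crd (~~ d) u = k :> nat -> cout g (d, u) != cin g (d, u) ->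
  2 * kappa (pattern g) <= rk g.
Proof.
move=> gi tb k0 ui uk un.
have [kap|kap] := leqP (kappa (pattern g)) 1.
  have := three_nontrivial k0 ui uk un.
  have : #|[set s in inner k | cout g s != cin g s]| <= 2 * rk g.
    exact: crank_ge_nontrivial (cout_inj gi).
  move: kap; clear; lia.
have := rk_ge_open gi; set e := prel _.
have ro : root e (mkp k true 0 0) \in roots e.
  exact: (roots_root (prel_connect_sym (pattern g))).
rewrite (bigD1 _ ro).
have := many_open_ends true gi tb kap; have := many_open_ends false gi tb kap.
rewrite -/e; set r0 := root e _ in ro *.
have kE : kappa (pattern g) = #|[pred i in roots e | i != r0]|.+1.
  rewrite /kappa (cardD1 r0) ro add1n; congr _.+1; apply: eq_card => r.
  by rewrite !inE andbC.
have : #|[pred i in roots e | i != r0]| * 2 <=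
    \sum_(i in roots e | i != r0) (#|open_ends g true i| + #|open_ends g false i|).
  rewrite -sum_nat_const; apply: leq_sum => r /andP[rr _].
  by have := open_ends_gt0 true rr; have := open_ends_gt0 false rr; clear; lia.
rewrite kE; set s := \sum_(i in _ | _) _; rewrite /=; clear; lia.
Qed.

(** * Restriction to a concentric box *)

Definition emb j k (u : box j) : box k := (inord (u.1 + (k - j)), inord (u.2 + (k - j))).

Definition restr n k j (f : {ffun box k -> vertex n}) : {ffun box j -> vertex n} :=
  [ffun u => f (emb k u)].

Lemma crd_emb j k d (u : box j) : j <= k -> crd d (emb k u) = crd d u + (k - j) :> nat.
Proof.
move=> jk; have h (i : 'I_j.*2.+1) : i + (k - j) < k.*2.+1.
  by have := ltn_ord i; move: jk; clear; lia.
by case: d; rewrite /= inordK.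
Qed.

Lemma emb_inj j k : j <= k -> injective (@emb j k).
Proof.
move=> jk u w uw; apply: (@crd_ext _ true); apply: val_inj => /=; apply: (@addIn (k - j)).
  by have := crd_emb true u jk; rewrite uw crd_emb.
by have := crd_emb false u jk; rewrite uw crd_emb.
Qed.

Lemma emb_inner j k d (u : box j) : j <= k -> (d, u) \in inner j -> (d, emb k u) \in inner k.
Proof. by move=> jk; rewrite !in_set /= crd_emb //; move: jk; clear; lia. Qed.

Lemma emb_step j k d (u : box j) : j <= k -> (d, u) \in inner j ->
  emb k (step d u) = step d (emb k u).
Proof.
move=> jk ui; have ui' := emb_inner jk ui.
apply: (@crd_ext _ d); apply: val_inj => /=.
  by rewrite crd_emb // (crd_step ui) (crd_step ui') crd_emb.
by rewrite crd_emb // !crd_stepN crd_emb.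
Qed.

Lemma cout_restr n j k (f : {ffun box k -> vertex n}) d (u : box j) :
  cout (restr j f) (d, u) = cout f (d, emb k u).
Proof. by rewrite /cout /= ffunE. Qed.

Lemma cin_restr n j k (f : {ffun box k -> vertex n}) d (u : box j) : j <= k ->
  (d, u) \in inner j -> cin (restr j f) (d, u) = cin f (d, emb k u).
Proof. by move=> jk ui; rewrite /cin /= ffunE emb_step. Qed.

Lemma emb_center j k : j <= k -> emb k (center j) = center k.
Proof.
move=> jk; rewrite /emb /center /= inordK ?subnKC //.
by clear; lia.
Qed.

Lemma inS_restr n q k j (sg : coloring n q) v (f : {ffun box k -> vertex n}) : j <= k ->
  inS sg v f -> inS sg v (restr j f).
Proof.
move=> jk /and3P[/injectiveP fi fv ff]; apply/and3P; split.
- by apply/injectiveP => u w; rewrite !ffunE => /fi /(emb_inj jk).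
- by rewrite ffunE emb_center.
rewrite !feasibleE in ff *; apply/forall_inP => -[d u] ui.
rewrite cout_restr cin_restr //; move/forall_inP: ff; apply; exact: emb_inner.
Qed.

Lemma moved_restr n k j (f : {ffun box k -> vertex n}) v alpha : 0 < j <= k ->
  List.In alpha ((0, 1) :: (0, -1) :: (1, 0) :: (-1, 0) :: nil)%Z ->
  moved (restr j f) v alpha = moved f v alpha.
Proof.
move=> /andP[j0 jk] ha; rewrite /moved ffunE.
have -> // : emb k (box_pt j alpha) = box_pt k alpha.
have h (a : Z) : (-1 <= a <= 1)%Z ->
    inord ((inord (Z.to_nat (Z.of_nat j + a)) : 'I_j.*2.+1) + (k - j)) =
    inord (Z.to_nat (Z.of_nat k + a)) :> 'I_k.*2.+1.
  move=> ha1; congr inord; rewrite inordK; move: ha1 j0 jk; clear;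
    by lia.
by rewrite /emb /box_pt /=; congr pair; apply: h;
  case: ha => [<-|[<-|[<-|[<-|[]]]]] /=; clear; lia.
Qed.

(** The box edge joining the center to [alpha] lies on a central line; were it trivial, [f] would
    not move [alpha]. For a negative [alpha] this edge starts at [alpha], which is [uo d], and ends
    at the center. *)
Lemma moved_nontrivial n q k (sg : coloring n q) v (f : {ffun box k -> vertex n}) alpha :
  0 < k -> List.In alpha ((0, 1) :: (0, -1) :: (1, 0) :: (-1, 0) :: nil)%Z ->
  inS sg v f -> moved f v alpha ->
  exists d u, [/\ (d, u) \in inner k, crd (~~ d) u = k :> nat & cout f (d, u) != cin f (d, u)].
Proof.
move=> k0 ha /and3P[_ /eqP fv _] mv.
have kk : k < k.*2.+1 by clear; lia.
have kp : k.+1 < k.*2.+1 by move: k0; clear; lia.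
have km : k.-1 < k.*2.+1 by move: k0; clear; lia.
have z0 : Z.to_nat (Z.of_nat k + 0) = k by clear; lia.
have z1 : Z.to_nat (Z.of_nat k + 1) = k.+1 by clear; lia.
have zm : Z.to_nat (Z.of_nat k + -1) = k.-1 by clear; lia.
have plus d : step d (center k) = if d then (inord k.+1, inord k) else (inord k, inord k.+1).
  by case: d; rewrite /step /center /= inordK.
have minus d : step d (if d then (inord k.-1, inord k) else (inord k, inord k.-1) : box k) = center k.
  by case: d; rewrite /step /center /= inordK // prednK.
pose uo d := if d then (inord k.-1, inord k) else (inord k, inord k.-1) : box k.
have cc d : crd (~~ d) (center k) = k :> nat by case: d; rewrite /= inordK.
have cu d : crd (~~ d) (uo d) = k :> nat by case: d; rewrite /= inordK.
have ci d : (d, center k) \in inner k by rewrite in_set; case: d; rewrite /= inordK.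
have ui d : (d, uo d) \in inner k by rewrite in_set; case: d; rewrite /= inordK // prednK.
case: ha mv => [<-|[<-|[<-|[<-|[]]]]]; rewrite /moved /box_pt /= ?z0 ?z1 ?zm => mv.
- exists false, (center k); split=> //; apply: contra mv; rewrite trivialE plus fv /=.
  by move=> /andP[/eqP h1 /eqP h2]; apply/andP; split; apply/Z.eqb_spec; rewrite ?h1 ?h2; clear; lia.
- exists false, (uo false); split=> //; apply: contra mv; rewrite trivialE minus fv /=.
  by move=> /andP[/eqP h1 /eqP h2]; apply/andP; split; apply/Z.eqb_spec; rewrite ?h1 -?h2 /uo; clear; lia.
- exists true, (center k); split=> //; apply: contra mv; rewrite trivialE plus fv /=.
  by move=> /andP[/eqP h1 /eqP h2]; apply/andP; split; apply/Z.eqb_spec; rewrite ?h1 ?h2; clear; lia.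
exists true, (uo true); split=> //; apply: contra mv; rewrite trivialE minus fv /=.
by move=> /andP[/eqP h1 /eqP h2]; apply/andP; split; apply/Z.eqb_spec; rewrite ?h1 -?h2 /uo; clear; lia.
Qed.

(** Pigeonhole: each constraint lies on a line at a single distance from the center, and fewer than
    k nontrivial ones cannot meet all the distances 1, ..., k. *)
Lemma trivial_level n k (f : {ffun box k -> vertex n}) :
  #|[set s in inner k | cout f s != cin f s]| < k ->
  exists2 j, 0 < j <= k & forall d u, (d, u) \in inner k ->
    crd (~~ d) u = k - j :> nat \/ crd (~~ d) u = k + j :> nat -> cout f (d, u) = cin f (d, u).
Proof.
set N := [set s in _ | _] => Nk; have k0 : 0 < k by apply: leq_ltn_trans Nk.
(* the distance from the center to the line carrying the edge, by truncated subtraction *)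
pose lev (s : bool * box k) := (crd (~~ s.1) s.2 - k) + (k - crd (~~ s.1) s.2).
(* Distance i+1 has index i. Distance 0 also goes to index 0, which can only enlarge the image of
   [N]. *)
pose h s : 'I_k := insubd (Ordinal k0) (lev s).-1.
have : ~~ ([set: 'I_k] \subset h @: N).
  apply/negP => /subset_leq_card; rewrite cardsT card_ord => /leq_trans/(_ (leq_imset_card h (mem N))).
  by rewrite leqNgt Nk.
move=> /subsetPn[i _ iN]; exists i.+1; first by rewrite /= ltn_ord.
move=> d u ui lv; apply/eqP/negPn/negP => un; move/negP: iN; apply.
apply/imsetP; exists (d, u); first by rewrite in_set ui un.
have le : lev (d, u) = i.+1.
  rewrite /lev /=; case: lv => ->; have := ltn_ord i; clear; lia.
by apply: val_inj; rewrite /h le insubdK // unfold_in /= ltn_ord.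
Qed.

(** If [f] itself fails the inequality, it has few nontrivial constraints, so some concentric square
    has a trivial boundary. There 2 kappa <= R, which is stronger than required. *)
Lemma good_restriction n q k (sg : coloring n q) v (f : {ffun box k -> vertex n}) alpha :
  0 < k -> List.In alpha ((0, 1) :: (0, -1) :: (1, 0) :: (-1, 0) :: nil)%Z ->
  inS sg v f -> moved f v alpha ->
  exists2 j, j <= k & 2 * k * kappa (pattern (restr j f)) <= (k + 9) * rk (restr j f).
Proof.
move=> k0 ha fS fm; have /and3P[/injectiveP fi _ _] := fS.
have rk_id : restr k f = f.
  apply/ffunP => u; rewrite ffunE /emb subnn !addn0 !inord_val; by case: (u).
have [h|h] := leqP (2 * k * kappa (pattern f)) ((k + 9) * rk f).
  by exists k; [exact: leqnn|rewrite rk_id].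
have [j jk tj] := trivial_level (few_nontrivial fi h).
have /andP[j0 jlek] := jk; exists j => //.
have gS := inS_restr jlek fS; have /and3P[/injectiveP gi _ _] := gS.
have gm : moved (restr j f) v alpha by rewrite moved_restr.
have [d [u [ui uj un]]] := moved_nontrivial j0 ha gS gm.
have tb : trivial_boundary (restr j f).
  move=> b w wi wj; rewrite cout_restr cin_restr //; apply: tj; first exact: emb_inner.
  by rewrite crd_emb //; case: wj => ->; [left|right]; move: jlek; clear; lia.
have := trivial_boundary_rank gi tb j0 ui uj un.
move: (kappa _) (rk _) => a b; clear; nia.
Qed.

(** * Union bound *)

Lemma INR_expn (m r : nat) : INR (expn m r) = pow (INR m) r.
Proof. by elim: r => [|r IH] //=; rewrite expnS -multE mult_INR IH. Qed.

Lemma INR_le (a b : nat) : a <= b -> Rle (INR a) (INR b).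
Proof. by move/leP; exact: le_INR. Qed.

Lemma INR_sum_le (I : finType) (P : pred I) (F : I -> nat) (b : R) :
  (forall i, P i -> Rle (INR (F i)) b) ->
  Rle (INR (\sum_(i | P i) F i)) (Rmult (INR #|P|) b).
Proof.
move=> h; rewrite -sum1_card; elim/big_ind2: _.
- by rewrite /= Rmult_0_l; exact: Rle_refl.
- by move=> a1 a2 b1 b2 h1 h2; rewrite -!plusE !plus_INR Rmult_plus_distr_r; exact: Rplus_le_compat.
by move=> i /h; rewrite /= Rmult_1_l.
Qed.

Lemma card_bigcup_le (T I : finType) (P : pred I) (F : I -> {set T}) :
  #|\bigcup_(i | P i) F i| <= \sum_(i | P i) #|F i|.
Proof.
elim/big_ind2: _ => [|A a B b hA hB|i _ //]; first by rewrite cards0.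
by apply: leq_trans (leq_add hA hB); rewrite cardsU leq_subr.
Qed.

(** The exponents satisfy (1 + eps) R >= 2 kappa + eps/2: the rank inequality gives 2 kappa <= R +
    9R/k, and 18 <= eps k bounds 9R/k by eps R/2. The other eps R/2 covers eps/2, as R >= 1. *)
Lemma Rpower_rank_bound (eps : R) (k n q kp r : nat) :
  Rlt 0 eps -> Rle (Rdiv 18 eps) (INR k) -> 0 < k -> 0 < n ->
  Rle (Rpower (INR n) (Rplus 1 eps)) (INR q) ->
  0 < kp -> 2 * k * kp <= (k + 9) * r ->
  Rle (Rpower (INR n) (Rplus (INR (2 * kp)) (Rdiv eps 2))) (pow (INR q) r).
Proof.
move=> e0 ke k0 n0 nq kp0 h.
have r0 : 0 < r by move: h kp0 k0; clear; nia.
have n1 : Rle 1 (INR n) by have := INR_le n0.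
apply: (Rle_trans _ (pow (Rpower (INR n) (Rplus 1 eps)) r)); last first.
  by apply: pow_incr; split=> //; apply: Rlt_le; exact: exp_pos.
rewrite -Rpower_pow; last exact: exp_pos.
rewrite Rpower_mult; apply: Rle_Rpower => //.
have r1 : Rle 1 (INR r) by have := INR_le r0.
have kR : Rlt 0 (INR k) by apply: lt_0_INR; apply/ltP.
have hR : Rle (Rmult (INR k) (INR (2 * kp))) (Rmult (Rplus (INR k) 9) (INR r)).
  have := INR_le h; rewrite (mulnC 2 k) -mulnA -!multE !mult_INR plus_INR.
  by rewrite (_ : INR 9 = (9 : R)) //=; lra.
have ke' : Rle 18 (Rmult eps (INR k)).
  apply: (Rmult_le_reg_r (Rinv eps)); first exact: Rinv_0_lt_compat.
  by field_simplify; try lra; move: ke; rewrite /Rdiv; lra.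
apply: (Rmult_le_reg_l (INR k)) => //.
have p1 : Rle (Rmult 18 (INR r)) (Rmult (Rmult eps (INR k)) (INR r)).
  by apply: Rmult_le_compat_r => //; lra.
have p2 : Rle (Rmult (Rmult eps (INR k)) 1) (Rmult (Rmult eps (INR k)) (INR r)).
  by apply: Rmult_le_compat_l => //; nra.
nra.
Qed.

(** The inequality keeps the original radius [k], to which [eps] is tied, although the map lives on
    the smaller box of radius [j]. *)
Definition good_maps n k j (v : vertex n) : {set {ffun box j -> vertex n}} :=
  [set g : {ffun box j -> vertex n} | [&& injectiveb g, g (center j) == v &
     2 * k * kappa (pattern g) <= (k + 9) * rk g]].

Definition feasible_set n q j (g : {ffun box j -> vertex n}) : {set coloring n q} :=
  [set sg : coloring n q | feasible sg g].

Lemma card_feasible_set n q j (g : {ffun box j -> vertex n}) :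
  #|feasible_set q g| * q ^ rk g <= #|{: coloring n q}|.
Proof.
have -> : #|{: coloring n q}| = q ^ (#|{: edge n}| - rk g) * q ^ rk g.
  by rewrite -expnD subnK ?leq_subr // card_ffun card_ord.
rewrite leq_mul2r; apply/orP; right.
rewrite /rk /crank subKn ?roots_le //.
apply: leq_trans (card_colorings_le _ _ _ q).
by apply: subset_leq_card; apply/subsetP => sg; rewrite !in_set feasibleE.
Qed.

(** A link of the pattern prescribes a unit displacement, so one image determines those of its whole
    cluster, and the center is sent to [v]. This is the count n^(2(kappa - 1)) in multiplicative
    form. *)
Lemma card_good_maps_pattern n k j (v : vertex n) p :
  #|[set g in good_maps k j v | pattern g == p]| * (n * n) <= n ^ (2 * kappa p).
Proof.
have -> : n ^ (2 * kappa p) = #|{: vertex n}| ^ #|roots (prel p)|.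
  by rewrite card_prod card_ord expnM -mulnn.
rewrite -[X in _ * (X * X)]card_ord -card_prod.
apply: (card_maps_by_roots (c := center j) (v := v) (prel_connect_sym p)) => [g g' u w|g].
  rewrite !in_set => /andP[_ /eqP gp] /andP[_ /eqP gp'] /existsP[d].
  have crd_eq (x y : vertex n) : crd d x = crd d y :> nat -> crd (~~ d) x = crd (~~ d) y -> x = y.
    by move=> h1 h2; apply: (@crd_ext _ d) => //; apply: val_inj.
  case/orP => h gu.
    have h' := h; rewrite -gp in h; rewrite -gp' in h'.
    have [a1 a2] := pattern_crd h; have [b1 b2] := pattern_crd h'.
    by apply: crd_eq; rewrite ?a1 ?a2 ?b1 ?b2 gu.
  have h' := h; rewrite -gp in h; rewrite -gp' in h'.
  have [a1 a2] := pattern_crd h; have [b1 b2] := pattern_crd h'.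
  apply: crd_eq; last by rewrite -a2 -b2 gu.
  by apply: succn_inj; rewrite -a1 -b1 gu.
by rewrite !in_set => /andP[/and3P[_ /eqP -> _] _].
Qed.

(** At most n^(2 kappa - 2) maps share the pattern, each feasible with probability at most n^(-2
    kappa - eps/2); kappa cancels in the product. *)
Lemma weighted_pattern_bound (eps : R) (k n q j : nat) (v : vertex n) p :
  Rlt 0 eps -> Rle (Rdiv 18 eps) (INR k) -> 0 < k -> 0 < n ->
  Rle (Rpower (INR n) (Rplus 1 eps)) (INR q) ->
  Rle (INR (\sum_(g in [set g in good_maps k j v | pattern g == p]) #|feasible_set q g|))
      (Rmult (INR #|{: coloring n q}|) (Rpower (INR n) (Rminus (Ropp 2) (Rdiv eps 2)))).
Proof.
move=> e0 ke k0 n0 nq; set G := [set g in _ | _].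
set Q := INR #|_|; set N := INR n.
have n1 : Rle 1 N by have := INR_le n0.
have Np x : Rlt 0 (Rpower N x) by exact: exp_pos.
pose b := Rmult Q (Rpower N (Ropp (Rplus (INR (2 * kappa p)) (Rdiv eps 2)))).
have Q0 : Rle 0 Q by exact: pos_INR.
have gb g : g \in G -> Rle (INR #|feasible_set q g|) b.
  rewrite in_set => /andP[]; rewrite in_set => /and3P[_ _ hg] /eqP gp.
  have := Rpower_rank_bound e0 ke k0 n0 nq (kappa_gt0 g) hg; rewrite -/N gp => hr.
  have := INR_le (card_feasible_set q g); rewrite -multE mult_INR INR_expn -/Q => hf.
  rewrite /b Rpower_Ropp.
  apply: (Rmult_le_reg_r (Rpower N (Rplus (INR (2 * kappa p)) (Rdiv eps 2)))) => //.
  rewrite Rmult_assoc Rinv_l ?Rmult_1_r; last by apply: Rgt_not_eq.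
  by apply: Rle_trans hf; apply: Rmult_le_compat_l => //; exact: pos_INR.
apply: (Rle_trans _ _ _ (INR_sum_le gb)).
have := INR_le (card_good_maps_pattern k v p); rewrite -/G -!multE !mult_INR INR_expn -/N.
rewrite -Rpower_pow ?multE => [hG|]; last by lra.
rewrite /b -Rmult_assoc (Rmult_comm (INR _)) Rmult_assoc; apply: Rmult_le_compat_l => //.
have -> : Rminus (Ropp 2) (Rdiv eps 2) =
    Rplus (Rplus (INR (2 * kappa p)) (Ropp 2)) (Ropp (Rplus (INR (2 * kappa p)) (Rdiv eps 2))) by lra.
rewrite Rpower_plus; apply: Rmult_le_compat_r; first exact: Rlt_le.
rewrite Rpower_plus Rpower_Ropp (_ : Rpower N 2 = Rmult N N); last first.
  by rewrite (_ : (2 : R) = INR 2) // Rpower_pow /=; lra.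
apply: (Rmult_le_reg_r (Rmult N N)); first by nra.
rewrite Rmult_assoc Rinv_l ?Rmult_1_r //.
by nra.
Qed.

(** The constant C(k). Patterns are sets on the box alone, so their number does not depend on n or
    q. *)
Definition pattern_count k : nat := \sum_(j < k.+1) #|{set bool * (box j * box j)}|.

Lemma card_bad_event_le n q k (v : vertex n) alpha : 0 < k ->
  List.In alpha ((0, 1) :: (0, -1) :: (1, 0) :: (-1, 0) :: nil)%Z ->
  #|[set sg | bad_event (q := q) k v alpha sg]| <=
   \sum_(j < k.+1) \sum_p
     \sum_(g in [set g in good_maps k j v | pattern g == p]) #|feasible_set q g|.
Proof.
move=> k0 ha.
apply: (@leq_trans #|\bigcup_(j < k.+1) \bigcup_p
    \bigcup_(g in [set g in good_maps k j v | pattern g == p]) feasible_set q g|).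
  apply: subset_leq_card; apply/subsetP => sg; rewrite in_set => /existsP[f /andP[fS fm]].
  have [j jk hj] := good_restriction k0 ha fS fm.
  have /and3P[gi gv gf] := inS_restr jk fS.
  apply/bigcupP; exists (Ordinal (jk : j < k.+1)) => //=.
  apply/bigcupP; exists (pattern (restr j f)) => //.
  apply/bigcupP; exists (restr j f); last by rewrite in_set.
  by rewrite in_set eqxx andbT in_set gi gv hj.
apply: leq_trans (card_bigcup_le _ _) _; apply: leq_sum => j _.
apply: leq_trans (card_bigcup_le _ _) _; apply: leq_sum => p _.
exact: card_bigcup_le.
Qed.

Theorem theorem2p1 :
  exists c : R, Rlt 0 c /\
  exists C : nat -> R,
  forall (eps : R), Rlt 0 eps ->
  forall k : nat, Rle (Rdiv c eps) (INR k) ->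
  forall n q : nat, (0 < n)%N -> (0 < q)%N ->
  Rle (Rpower (INR n) (Rplus 1 eps)) (INR q) ->
  forall (v : vertex n) (alpha : Z * Z),
    List.In alpha ((0, 1) :: (0, -1) :: (1, 0) :: (-1, 0) :: nil)%Z ->
    Rle (prob_unif (bad_event (q := q) k v alpha))
        (Rmult (C k) (Rpower (INR n) (Rminus (Ropp 2) (Rdiv eps 2)))).
Proof.
exists (18 : R); split; first by lra.
exists (fun k => INR (pattern_count k)) => eps e0 k ke n q n0 q0 nq v alpha ha.
have k0 : 0 < k.
  apply/ltP; apply: INR_lt; apply: Rlt_le_trans ke.
  by apply: Rdiv_lt_0_compat => //; lra.
have Q0 : Rlt 0 (INR #|{: coloring n q}|).
  by apply: lt_0_INR; apply/ltP; rewrite card_ffun card_ord expn_gt0 q0.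
rewrite /prob_unif; apply: (Rmult_le_reg_r (INR #|{: coloring n q}|)) => //.
rewrite /Rdiv Rmult_assoc Rinv_l ?Rmult_1_r; last exact: Rgt_not_eq.
apply: (Rle_trans _ _ _ (INR_le (card_bad_event_le q v k0 ha))).
rewrite Rmult_assoc (Rmult_comm (Rpower _ _)).
set b := Rmult _ (Rpower _ _).
rewrite /pattern_count; elim/big_ind2: _.
- by rewrite /= Rmult_0_l; exact: Rle_refl.
- by move=> a1 a2 b1 b2 h1 h2; rewrite -!plusE !plus_INR Rmult_plus_distr_r; exact: Rplus_le_compat.
move=> j _; apply: INR_sum_le => p _; exact: weighted_pattern_bound.
Qed.
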